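(* Let $K$ be a field of characteristic not $2$ or $3$, let $\mathcal{A}_\alpha:=(A,[\cdot,\cdot],\{\cdot,\cdot,\cdot\},\alpha)$ be a Hom-Bol superalgebra over $K$, and let $\beta:A\to A$ be an even self-morphism of $\mathcal{A}_\alpha$ such that $\alpha\circ\beta=\beta\circ\alpha$. Let $\beta^0=\mathrm{Id}$ and $\beta^n=\beta\circ\beta^{n-1}$ for $n\ge 1$. For an integer $n\ge0$ define on $A$ the operations $$[x,y]_{\beta^n}:=\beta^n([x,y]),\qquad \{x,y,z\}_{\beta^n}:=\beta^{2n}(\{x,y,z\}).$$ Then, for every integer $n\geq 0$, $\mathcal{A}_{\beta^n}:=(A,[\cdot,\cdot]_{\beta^n},\{\cdot,\cdot,\cdot\}_{\beta^n},\beta^n\circ\alpha)$ is a Hom-Bol superalgebra.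
   Context: A superspace is a $\mathbb{Z}_2$-graded vector space $A=A_0\oplus A_1$; an element $x\in A_i$ is homogeneous of degree $\bar x=i$. A linear map $f:A\to A$ is even if $f(A_i)\subset A_i$ for $i=0,1$. A Hom-Bol superalgebra is a quadruple $(A,[\cdot,\cdot],\{\cdot,\cdot,\cdot\},\alpha)$ where $A$ is a superspace, $[\cdot,\cdot]$ is a bilinear and $\{\cdot,\cdot,\cdot\}$ a trilinear operation on $A$, both compatible with the grading ($[A_i,A_j]\subset A_{i+j}$, $\{A_i,A_j,A_k\}\subset A_{i+j+k}$), and $\alpha:A\to A$ is an even linear map, such that for all homogeneous $u,v,w,x,y,z\in A$: (1) $\alpha([x,y])=[\alpha(x),\alpha(y)]$; (2) $\alpha(\{x,y,z\})=\{\alpha(x),\alpha(y),\alpha(z)\}$; (3) $[x,y]=-(-1)^{\bar x\bar y}[y,x]$; (4) $\{x,y,z\}=-(-1)^{\bar x\bar y}\{y,x,z\}$; (5) $\{x,y,z\}+(-1)^{\bar x(\bar y+\bar z)}\{y,z,x\}+(-1)^{\bar z(\bar x+\bar y)}\{z,x,y\}=0$; (6) $\{\alpha(x),\alpha(y),[u,v]\}=[\{x,y,u\},\alpha^2(v)]+(-1)^{\bar u(\bar x+\bar y)}[\alpha^2(u),\{x,y,v\}]+(-1)^{(\bar x+\bar y)(\bar u+\bar v)}\big(\{\alpha(u),\alpha(v),[x,y]\}-[[\alpha(u),\alpha(v)],[\alpha(x),\alpha(y)]]\big)$; (7) $\{\alpha^2(x),\alpha^2(y),\{u,v,w\}\}=\{\{x,y,u\},\alpha^2(v),\alpha^2(w)\}+(-1)^{\bar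 u(\bar x+\bar y)}\{\alpha^2(u),\{x,y,v\},\alpha^2(w)\}+(-1)^{(\bar x+\bar y)(\bar u+\bar v)}\{\alpha^2(u),\alpha^2(v),\{x,y,w\}\}$. An even self-morphism $\beta$ of $\mathcal{A}_\alpha$ is an even linear map $\beta:A\to A$ with $\beta([x,y])=[\beta(x),\beta(y)]$ and $\beta(\{x,y,z\})=\{\beta(x),\beta(y),\beta(z)\}$ for all $x,y,z\in A$ (and commuting with $\alpha$, as stated in the claim). *)

(* Defs.v *)
From HB Require Import structures.
From mathcomp Require Import all_boot all_order all_algebra.
Set Implicit Arguments.
Unset Strict Implicit.
Unset Printing Implicit Defensive.
Import GRing.Theory.
Local Open Scope ring_scope.

(* No finiteness is assumed on the carrier, and the homogeneous components
   are Prop-valued, so that they need not be decidable.  The zero vector lies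
   in both components. *)
Record superspace (K : fieldType) := Superspace {
  carrier :> lmodType K;
  hom : 'Z_2 -> carrier -> Prop;
  hom0 : forall i, hom i 0;
  hom_lin : forall i (a : K) x y, hom i x -> hom i y -> hom i (a *: x + y);
  hom_span : forall x, exists x0 x1, [/\ hom 0 x0, hom 1 x1 & x = x0 + x1];
  hom_direct : forall x, hom 0 x -> hom 1 x -> x = 0
}.

(* The sign (-1)^d, for a degree d computed in 'Z_2. *)
Definition sgn (K : fieldType) (d : 'Z_2) : K := (-1) ^+ (val d).

Definition even_linear (K : fieldType) (A : superspace K) (f : A -> A) : Prop :=
  linear f /\ forall i x, hom i x -> hom i (f x).

Record hom_bol_superalgebra (K : fieldType) (A : superspace K)
    (br : A -> A -> A) (tr : A -> A -> A -> A) (alpha : A -> A) : Prop :=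
  HomBolSuperalgebra {
  br_linl : forall y, linear (fun x => br x y);
  br_linr : forall x, linear (fun y => br x y);
  br_hom : forall i j x y, hom i x -> hom j y -> hom (i + j) (br x y);
  tr_lin1 : forall y z, linear (fun x => tr x y z);
  tr_lin2 : forall x z, linear (fun y => tr x y z);
  tr_lin3 : forall x y, linear (fun z => tr x y z);
  tr_hom : forall i j k x y z, hom i x -> hom j y -> hom k z ->
    hom (i + j + k) (tr x y z);
  alpha_even : even_linear alpha;
  alpha_br : forall i j x y, hom i x -> hom j y ->
    alpha (br x y) = br (alpha x) (alpha y);
  alpha_tr : forall i j k x y z, hom i x -> hom j y -> hom k z ->
    alpha (tr x y z) = tr (alpha x) (alpha y) (alpha z);
  br_skew : forall i j x y, hom i x -> hom j y ->
    br x y = - (sgn K (i * j) *: br y x);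
  tr_skew : forall i j k x y z, hom i x -> hom j y -> hom k z ->
    tr x y z = - (sgn K (i * j) *: tr y x z);
  tr_cyclic : forall i j k x y z, hom i x -> hom j y -> hom k z ->
    tr x y z + sgn K (i * (j + k)) *: tr y z x
      + sgn K (k * (i + j)) *: tr z x y = 0;
  tr_br : forall i j k l x y u v,
    hom i x -> hom j y -> hom k u -> hom l v ->
    tr (alpha x) (alpha y) (br u v) =
      br (tr x y u) (alpha (alpha v))
      + sgn K (k * (i + j)) *: br (alpha (alpha u)) (tr x y v)
      + sgn K ((i + j) * (k + l)) *:
          (tr (alpha u) (alpha v) (br x y)
           - br (br (alpha u) (alpha v)) (br (alpha x) (alpha y)));
  tr_tr : forall i j k l m x y u v w,
    hom i x -> hom j y -> hom k u -> hom l v -> hom m w ->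
    tr (alpha (alpha x)) (alpha (alpha y)) (tr u v w) =
      tr (tr x y u) (alpha (alpha v)) (alpha (alpha w))
      + sgn K (k * (i + j)) *:
          tr (alpha (alpha u)) (tr x y v) (alpha (alpha w))
      + sgn K ((i + j) * (k + l)) *:
          tr (alpha (alpha u)) (alpha (alpha v)) (tr x y w)
}.

(* Commutation with alpha is not included; it is a separate hypothesis. *)
Record even_self_morphism (K : fieldType) (A : superspace K)
    (br : A -> A -> A) (tr : A -> A -> A -> A) (beta : A -> A) : Prop :=
  EvenSelfMorphism {
  beta_even : even_linear beta;
  beta_br : forall x y, beta (br x y) = br (beta x) (beta y);
  beta_tr : forall x y z, beta (tr x y z) = tr (beta x) (beta y) (beta z)
}.

(* Main.v *)
(** An even self-morphism [g] commuting with [alpha] twists the structure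
    [([,], {,,}, alpha)] into [(g [,], g^2 {,,}, g alpha)]: pulling [g] out of
    the operations, every identity of the twisted structure is the image under a
    fixed power of [g] (the power is 3 for the bracket-triple compatibility, 4
    for the triple-triple one) of the same identity of the original structure.
    The theorem is the case [g = beta^n]. *)
Require Import Defs.
From HB Require Import structures.
From mathcomp Require Import all_boot all_order all_algebra.
Import GRing.Theory.
Local Open Scope ring_scope.

Section Twist.
Set Implicit Arguments.
Unset Strict Implicit.
Variables (K : fieldType) (A : superspace K).
Variables (br : A -> A -> A) (tr : A -> A -> A -> A).

Lemma linear_comp (f h : A -> A) :
  linear f -> linear h -> linear (fun x => f (h x)).
Proof. by move=> f_lin h_lin a x y; rewrite h_lin f_lin. Qed.

Lemma even_linear_comp (f g : A -> A) :
  even_linear f -> even_linear g -> even_linear (f \o g).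
Proof.
move=> [f_lin f_hom] [g_lin g_hom]; split; first exact: linear_comp.
by move=> i x hx; apply/f_hom/g_hom.
Qed.

Lemma even_self_morphism_iter (beta : A -> A) n :
  even_self_morphism br tr beta -> even_self_morphism br tr (iter n beta).
Proof.
move=> [beta_ev betaB betaT]; elim: n => [|n [IHev IHB IHT]].
  by split=> //; split.
split; first exact: (even_linear_comp beta_ev IHev).
- by move=> x y; rewrite !iterS IHB betaB.
- by move=> x y z; rewrite !iterS IHT betaT.
Qed.

(** Give the bracket and [alpha] weight 1 and the triple product weight 2. In each identity, the
    operations enclosing any variable in any term have the same total weight, which is the power of
    [g] that factors out. *)
Lemma hom_bol_twist (alpha g : A -> A) :
  hom_bol_superalgebra br tr alpha -> even_self_morphism br tr g ->
  alpha \o g =1 g \o alpha ->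
  hom_bol_superalgebra (fun x y => g (br x y)) (fun x y z => g (g (tr x y z)))
    (g \o alpha).
Proof.
move=> hA [g_ev gB gT] ag; have [g_lin g_hom] := g_ev.
have agE x : alpha (g x) = g (alpha x) by exact: ag.
(* Bundling [g] gives access to the generic linearity facts, restated for the bare [g] so that they
   rewrite the goals. *)
pose gL : {linear A -> A} := HB.pack g (GRing.isLinear.Build K A A *:%R g g_lin).
have gD : {morph g : x y / x + y} := linearD gL.
have gZ : scalable g := linearZZ gL.
have gN : {morph g : x / - x} := linearN gL.
have g0 : g 0 = 0 := linear0 gL.
have gg_lin : linear (fun x => g (g x)) by exact: linear_comp.
split=> /=.
- by move=> y; apply: (linear_comp g_lin); apply: (br_linl hA).
- by move=> x; apply: (linear_comp g_lin); apply: (br_linr hA).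
- by move=> i j x y hx hy; apply/g_hom/(br_hom hA).
- by move=> y z; apply: (linear_comp gg_lin); apply: (tr_lin1 hA).
- by move=> x z; apply: (linear_comp gg_lin); apply: (tr_lin2 hA).
- by move=> x y; apply: (linear_comp gg_lin); apply: (tr_lin3 hA).
- by move=> i j k x y z hx hy hz; apply/g_hom/g_hom/(tr_hom hA).
- exact: (even_linear_comp g_ev (alpha_even hA)).
- by move=> i j x y hx hy; rewrite agE (alpha_br hA hx hy) gB.
- by move=> i j k x y z hx hy hz; rewrite !agE (alpha_tr hA hx hy hz) gT.
- by move=> i j x y hx hy; rewrite (br_skew hA hx hy) gN gZ.
- by move=> i j k x y z hx hy hz; rewrite (tr_skew hA hx hy hz) !(gN, gZ).
- move=> i j k x y z hx hy hz.
  (* Signs and sums move inside both copies of [g], leaving the original cyclic sum as argument. *)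
  by rewrite -!gZ -!gD (tr_cyclic hA hx hy hz) !g0.
- move=> i j k l x y u v hx hy hu hv.
  (* Moving [g] out past [alpha], then out of the operations, exposes the original left-hand side
     under three copies of [g]. *)
  rewrite !agE -!(gB, gT) (tr_br hA hx hy hu hv).
  by rewrite !(gD, gZ, gN).
- move=> i j k l m x y u v w hx hy hu hv hw.
  rewrite !agE -!gT (tr_tr hA hx hy hu hv hw).
  by rewrite !(gD, gZ).
Qed.

End Twist.

Theorem theorem4p1 (K : fieldType)
    (charK2 : 2%N \notin [pchar K]) (charK3 : 3%N \notin [pchar K])
    (A : superspace K) (br : A -> A -> A) (tr : A -> A -> A -> A)
    (alpha beta : A -> A)
    (hA : hom_bol_superalgebra br tr alpha)
    (hbeta : even_self_morphism br tr beta)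
    (comm_alpha_beta : alpha \o beta =1 beta \o alpha)
    (n : nat) :
  hom_bol_superalgebra
    (fun x y => iter n beta (br x y))
    (fun x y z => iter (2 * n)%N beta (tr x y z))
    (iter n beta \o alpha).
Proof.
have comm_iter : alpha \o iter n beta =1 iter n beta \o alpha.
  move=> x /=; elim: n => //= n <-; exact: comm_alpha_beta.
have [l1 l2 hB t1 t2 t3 hT ev aB aT sB sT cyc tB tT] :=
  hom_bol_twist hA (even_self_morphism_iter n hbeta) comm_iter.
(* The twist yields the triple product with [iter n beta] applied twice. This agrees with the stated
   one only pointwise, so every field involving the triple product is transported separately. *)
have iter2 x : iter (2 * n) beta x = iter n beta (iter n beta x).
  by rewrite mul2n -addnn iterD.
split=> //.
- by move=> y z a u v; rewrite !iter2; apply: t1.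
- by move=> x z a u v; rewrite !iter2; apply: t2.
- by move=> x y a u v; rewrite !iter2; apply: t3.
- by move=> *; rewrite !iter2; apply: hT.
- by move=> i j k x y z hx hy hz; rewrite !iter2; apply: (aT i j k).
- by move=> i j k x y z hx hy hz; rewrite !iter2; apply: (sT i j k).
- by move=> i j k x y z hx hy hz; rewrite !iter2; apply: cyc.
- by move=> i j k l x y u v hx hy hu hv; rewrite !iter2; apply: tB.
- by move=> i j k l m x y u v w hx hy hu hv hw; rewrite !iter2; apply: (tT i j k l m).
Qed.
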